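(* Consider the multiplayer reach-avoid differential game with $m$ evaders and $n\ge m\ge1$ pursuers, under the assumption that (i) each pursuer can capture at most one evader and each evader is pursued by one pursuer, (ii) $n\ge m$, (iii) pursuers commit to their assignments throughout the game. For each state $\mathbf{x}\in\mathbb{R}^{3(m+n)}$ let the penalty $L>0$ satisfy $L>L^\star(\mathbf{x})$, and for $\bm{\gamma}^\star\in\Gamma^\star(\mathbf{x})$ let $B_{\bm{\gamma}^\star}(\mathbf{x})=\min_{i\in M}\Psi_i((\mathbf{x}_{E_i},\mathbf{x}_P),\bm{\gamma}^\star)$. Then the pursuer and evader winning regions are respectively $$\mathsf{R}_P=\{\mathbf{x}\in\mathbb{R}^{3(m+n)}:B_{\bm{\gamma}^\star}(\mathbf{x})>0\ \text{for any }\bm{\gamma}^\star\in\Gamma^\star(\mathbf{x})\},\qquad \mathsf{R}_E=\{\mathbf{x}\in\mathbb{R}^{3(m+n)}:B_{\bm{\gamma}^\star}(\mathbf{x})\le0\ \text{for any }\bm{\gamma}^\star\in\Gamma^\star(\mathbf{x})\}.$$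
   Context: Multiplayer reach-avoid differential game (MRADG): evaders $E_i$, $i\in M=\{1,\dots,m\}$, and pursuers $P_j$, $j\in N=\{1,\dots,n\}$, have positions $\mathbf{x}_{E_i},\mathbf{x}_{P_j}\in\mathbb{R}^3$, dynamics $\dot{\mathbf{x}}_{E_i}=\mathbf{u}_i$, $\dot{\mathbf{x}}_{P_j}=\mathbf{v}_j$, $\|\mathbf{u}_i\|=U_i>0$, $\|\mathbf{v}_j\|=V_j>0$, and $\alpha_{ij}=U_i/V_j$; the state is $\mathbf{x}=(\mathbf{x}_{E_1},\dots,\mathbf{x}_{E_m},\mathbf{x}_{P_1},\dots,\mathbf{x}_{P_n})\in\mathbb{R}^{3(m+n)}$, $\mathbf{x}_P=(\mathbf{x}_{P_1},\dots,\mathbf{x}_{P_n})$. The target is the origin. Pursuers are assigned to evaders by binary variables $\mu_{ij}$ ($\mu_{ij}=1$ iff $P_j$ is assigned to capture $E_i$). An evader is captured when its position coincides with that of a pursuer assigned to it; then both stop. The game ends when all evaders have been captured away from the target (pursuer team wins) or at least one evader reaches the target (evader team wins). Winning regions: $\mathsf{R}_P$ (resp. $\mathsf{R}_E$) is the set of initial states from which there is a strategy for the pursuer (resp. evader) team that guarantees a win for that team independently of the other team's strategy; initial states resulting in a pursuer and an evader reaching the target simultaneously are counted in $\mathsf{R}_E$. Let $\mathbf{1}_k$ be the all-ones column vector of size $k$. $\Sigma=\{\bm{\mu}\in\{0,1\}^{m\times n}:\bm{\mu}\mathbf{1}_n=\mathbf{1}_m,\ \bm{\mu}^T\mathbf{1}_m\le\mathbf{1}_n\}$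 (feasible assignments), $\Gamma=\{\bm{\gamma}\in[0,1]^{m\times n}:\bm{\gamma}\mathbf{1}_n=\mathbf{1}_m,\ \bm{\gamma}^T\mathbf{1}_m\le\mathbf{1}_n\}$. $B_{ij}(\mathbf{x}_{E_i},\mathbf{x}_{P_j})=\|\mathbf{x}_{E_i}\|^2-\alpha_{ij}^2\|\mathbf{x}_{P_j}\|^2$. When $B_{ij}>0$ and $\alpha_{ij}<1$, $\mathcal{V}^P_{ij}=\Big\|\frac{\mathbf{x}_{E_i}-\alpha_{ij}^2\mathbf{x}_{P_j}}{1-\alpha_{ij}^2}\Big\|-\frac{\alpha_{ij}}{1-\alpha_{ij}^2}\|\mathbf{x}_{P_j}-\mathbf{x}_{E_i}\|$; when $B_{ij}>0$ and $\alpha_{ij}=1$, $\mathcal{V}^P_{ij}=\frac{\|\mathbf{x}_{E_i}\|^2-\|\mathbf{x}_{P_j}\|^2}{2\|\mathbf{x}_{E_i}-\mathbf{x}_{P_j}\|}$ (in both cases $\mathcal{V}^P_{ij}>0$). $a_{ij}(\mathbf{x}_{E_i},\mathbf{x}_{P_j})=\mathcal{V}^P_{ij}$ if $B_{ij}>0$ and $\alpha_{ij}\le 1$, and $a_{ij}=-L$ otherwise. $\Psi_i((\mathbf{x}_{E_i},\mathbf{x}_P),\bm{\gamma})=\sum_{j\in N}a_{ij}(\mathbf{x}_{E_i},\mathbf{x}_{P_j})\gamma_{ij}$, $\Psi(\mathbf{x},\bm{\gamma})=\sum_{i\in M}\Psi_i((\mathbf{x}_{E_i},\mathbf{x}_P),\bm{\gamma})$.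 $\Gamma^\star(\mathbf{x})$ is the set of extreme-point maximizers of $\Psi(\mathbf{x},\cdot)$ over $\Gamma$; these are elements of $\Sigma$. ''For any'' is unambiguous because the sign condition does not depend on the choice of $\bm{\gamma}^\star\in\Gamma^\star(\mathbf{x})$. Under an assignment $\bm{\mu}\in\Sigma$, a pairing $ij$ with $\mu_{ij}=1$ and $a_{ij}>0$ is one where the pursuer wins ($E_i$ is captured by $P_j$ away from the target), and a pairing with $\mu_{ij}=1$ and $a_{ij}\le 0$ is one where the pursuer loses ($E_i$ is counted as reaching the target). $L^\star(\mathbf{x})=\sum_{i\in M}\max_{j\in\hat{N}_i}\mathcal{V}^P_{ij}$, $\hat{N}_i=\{j\in N:B_{ij}>0,\ \alpha_{ij}\le1\}$, a maximum over the empty set being $0$. The penalty $L$ may depend on $\mathbf{x}$.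
   Formalization: A coincidence of evader and assigned pursuer counts as capture only if their positions differed earlier; otherwise states with x_E = x_P ≠ 0 and speed ratio ≥ 1 would be captured at time 0 though the formula places them in the evader region. *)

(* Defs.v *)
(* MathComp world, with MathComp-Analysis over an abstract realType. *)
From HB Require Import structures.
From mathcomp Require Import all_boot all_order all_algebra.
From mathcomp Require Import all_classical all_reals all_analysis.

Set Implicit Arguments.
Unset Strict Implicit.
Unset Printing Implicit Defensive.

Import Order.TTheory GRing.Theory Num.Theory.
Import numFieldNormedType.Exports.

Local Open Scope classical_set_scope.
Local Open Scope ring_scope.

(* The library norm on 'rV[R]_k is the sup norm, hence this definition. *)
Definition enorm (R : realType) (k : nat) (v : 'rV[R]_k) : R :=
  Num.sqrt (\sum_(l < k) v 0 l ^+ 2).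

(* x.1 i is the position of evader i and x.2 j that of pursuer j. *)
Definition state (R : realType) (m n : nat) : Type :=
  (('I_m -> 'rV[R]_3) * ('I_n -> 'rV[R]_3))%type.

(* Static data: barrier, values, assignments. *)

Definition alpha (R : realType) (m n : nat) (U : 'I_m -> R) (V : 'I_n -> R)
    (i : 'I_m) (j : 'I_n) : R :=
  U i / V j.

Definition barrier (R : realType) (m n : nat) (U : 'I_m -> R) (V : 'I_n -> R)
    (x : state R m n) (i : 'I_m) (j : 'I_n) : R :=
  enorm (x.1 i) ^+ 2 - alpha U V i j ^+ 2 * enorm (x.2 j) ^+ 2.

(* Only meaningful (and only used) when 0 < barrier and alpha <= 1. *)
Definition value_P (R : realType) (m n : nat) (U : 'I_m -> R) (V : 'I_n -> R)
    (x : state R m n) (i : 'I_m) (j : 'I_n) : R :=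
  let a := alpha U V i j in
  if a < 1 then
    enorm ((1 - a ^+ 2)^-1 *: (x.1 i - a ^+ 2 *: x.2 j))
    - a / (1 - a ^+ 2) * enorm (x.2 j - x.1 i)
  else
    (enorm (x.1 i) ^+ 2 - enorm (x.2 j) ^+ 2) / (2 * enorm (x.1 i - x.2 j)).

Definition favorable (R : realType) (m n : nat) (U : 'I_m -> R) (V : 'I_n -> R)
    (x : state R m n) (i : 'I_m) (j : 'I_n) : bool :=
  (0 < barrier U V x i j) && (alpha U V i j <= 1).

Definition payoff (R : realType) (m n : nat) (U : 'I_m -> R) (V : 'I_n -> R)
    (L : R) (x : state R m n) (i : 'I_m) (j : 'I_n) : R :=
  if favorable U V x i j then value_P U V x i j else - L.

(* The default 0 is the value of an empty maximum; the other terms are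
   positive. *)
Definition Lstar (R : realType) (m n : nat) (U : 'I_m -> R) (V : 'I_n -> R)
    (x : state R m n) : R :=
  \sum_(i < m) \big[Num.max/0]_(j < n | favorable U V x i j) value_P U V x i j.

Definition row_col_sums (R : realType) (m n : nat) (g : 'M[R]_(m, n)) : Prop :=
  g *m const_mx 1 = const_mx 1 :> 'cV[R]_m /\
  forall j, (g^T *m (const_mx 1 : 'cV[R]_m)) j 0 <= 1.

Definition Sigma (R : realType) (m n : nat) : set 'M[R]_(m, n) :=
  [set mu : 'M[R]_(m, n) | (forall i j, mu i j = 0 \/ mu i j = 1) /\ row_col_sums mu].

Definition Gamma (R : realType) (m n : nat) : set 'M[R]_(m, n) :=
  [set g : 'M[R]_(m, n) | (forall i j, 0 <= g i j <= 1) /\ row_col_sums g].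

Definition Psi_row (R : realType) (m n : nat) (U : 'I_m -> R) (V : 'I_n -> R)
    (L : R) (x : state R m n) (g : 'M[R]_(m, n)) (i : 'I_m) : R :=
  \sum_(j < n) payoff U V L x i j * g i j.

Definition Psi (R : realType) (m n : nat) (U : 'I_m -> R) (V : 'I_n -> R)
    (L : R) (x : state R m n) (g : 'M[R]_(m, n)) : R :=
  \sum_(i < m) Psi_row U V L x g i.

Definition extreme_point (R : realType) (m n : nat) (C : set 'M[R]_(m, n))
    (g : 'M[R]_(m, n)) : Prop :=
  C g /\
  forall (g1 g2 : 'M[R]_(m, n)) (t : R), C g1 -> C g2 -> 0 < t < 1 ->
    g = t *: g1 + (1 - t) *: g2 -> g1 = g /\ g2 = g.

Definition Gamma_star (R : realType) (m n : nat) (U : 'I_m -> R) (V : 'I_n -> R)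
    (L : R) (x : state R m n) : set 'M[R]_(m, n) :=
  [set g | extreme_point (@Gamma R m n) g /\
           forall h, Gamma h -> Psi U V L x h <= Psi U V L x g].

(* The range is finite, and nonempty when 0 < m, so inf is a minimum. *)
Definition team_barrier (R : realType) (m n : nat) (U : 'I_m -> R)
    (V : 'I_n -> R) (L : R) (x : state R m n) (g : 'M[R]_(m, n)) : R :=
  inf (range (Psi_row U V L x g)).

(* Motions p : R -> state R m n, considered at times t >= 0. *)

(* A coincidence counts as a capture only if the two positions differed
   earlier, so coinciding from the start is not yet a capture: states with
   x_Ei = x_Pj <> 0 and alpha_ij >= 1 have barrier_ij <= 0 and must be losing
   for P_j, the evader running straight to the target. *)
Definition captured_at (R : realType) (m n : nat) (mu : 'M[R]_(m, n))
    (p : R -> state R m n) (i : 'I_m) (j : 'I_n) (t : R) : Prop :=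
  [/\ mu i j = 1, (p t).1 i = (p t).2 j &
      exists2 s, 0 <= s < t & (p s).1 i <> (p s).2 j].

Definition captured_by (R : realType) (m n : nat) (mu : 'M[R]_(m, n))
    (p : R -> state R m n) (i : 'I_m) (j : 'I_n) (t : R) : Prop :=
  exists2 s, 0 <= s <= t & captured_at mu p i j s.

Definition captured_away (R : realType) (m n : nat) (mu : 'M[R]_(m, n))
    (p : R -> state R m n) (i : 'I_m) (j : 'I_n) : Prop :=
  exists t, [/\ 0 <= t, captured_at mu p i j t &
                forall s, 0 <= s <= t -> (p s).1 i <> 0].

(* Captures at time t itself are not excluded: simultaneous arrival at the
   target is credited to the evader. *)
Definition reaches_target (R : realType) (m n : nat) (mu : 'M[R]_(m, n))
    (p : R -> state R m n) (i : 'I_m) : Prop :=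
  exists t, [/\ 0 <= t, (p t).1 i = 0 &
                forall s j, 0 <= s < t -> ~ captured_at mu p i j s].

Definition pursuers_win (R : realType) (m n : nat) (mu : 'M[R]_(m, n))
    (p : R -> state R m n) : Prop :=
  forall i, exists j, captured_away mu p i j.

Definition evaders_win (R : realType) (m n : nat) (mu : 'M[R]_(m, n))
    (p : R -> state R m n) : Prop :=
  exists i, reaches_target mu p i.

(* q is driven by a measurable control of norm c, and of norm 0 once stopped. *)
Definition driven (R : realType) (c : R) (stopped : R -> Prop)
    (q : R -> 'rV[R]_3) : Prop :=
  exists u : R -> 'rV[R]_3,
    (forall k, measurable_fun setT (fun t => u t 0 k)) /\
    forall t, 0 <= t ->
      [/\ stopped t -> enorm (u t) = 0,
          ~ stopped t -> enorm (u t) = c &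
          forall k, q t 0 k =
            q 0 0 k + \int[@lebesgue_measure R]_(s in `[0, t]) u s 0 k].

Definition admissible_motion (R : realType) (m n : nat) (U : 'I_m -> R)
    (V : 'I_n -> R) (x : state R m n) (mu : 'M[R]_(m, n))
    (p : R -> state R m n) : Prop :=
  [/\ p 0 = x,
      forall i, driven (U i) (fun t => exists j, captured_by mu p i j t)
                       (fun t => (p t).1 i) &
      forall j, driven (V j) (fun t => exists i, captured_by mu p i j t)
                       (fun t => (p t).2 j)].

(* An information pattern: the strategies available to each player, and the
   motion generated by an initial state, a committed assignment and a strategy
   profile. Leaving it abstract avoids fixing one of the inequivalent notions
   of strategy (feedback, nonanticipative, open loop, ...). *)
Record game (R : realType) (m n : nat) (U : 'I_m -> R) (V : 'I_n -> R) := Game {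
  estrat : 'I_m -> Type;
  pstrat : 'I_n -> Type;
  estrat_point : forall i, estrat i;
  pstrat_point : forall j, pstrat j;
  motion : state R m n -> 'M[R]_(m, n) ->
    (forall i, estrat i) -> (forall j, pstrat j) -> R -> state R m n;
  motion_admissible : forall x mu e s, Sigma mu ->
    admissible_motion U V x mu (motion x mu e s)
}.

Arguments motion {R m n U V} _ _ _ _ _ _.

(* A strategy of the pursuer team consists of a committed assignment together
   with a strategy for each pursuer; the evaders respond to the assignment. *)

Definition winning_P (R : realType) (m n : nat) (U : 'I_m -> R) (V : 'I_n -> R)
    (G : game U V) : set (state R m n) :=
  [set x | exists (mu : 'M[R]_(m, n)) (s : forall j, pstrat G j),
     Sigma mu /\
     forall e : 'M[R]_(m, n) -> forall i, estrat G i,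
       pursuers_win mu (motion G x mu (e mu) s)].

Definition winning_E (R : realType) (m n : nat) (U : 'I_m -> R) (V : 'I_n -> R)
    (G : game U V) : set (state R m n) :=
  [set x | exists e : 'M[R]_(m, n) -> forall i, estrat G i,
     forall (mu : 'M[R]_(m, n)) (s : forall j, pstrat G j),
       Sigma mu -> evaders_win mu (motion G x mu (e mu) s)].

(* The outcome of each assigned pairing is that of the one-on-one game: its
   winner can enforce it whatever all the other players do. *)
Definition one_on_one_outcomes (R : realType) (m n : nat) (U : 'I_m -> R)
    (V : 'I_n -> R) (L : state R m n -> R) (G : game U V) : Prop :=
  forall (x : state R m n) (mu : 'M[R]_(m, n)) (i : 'I_m) (j : 'I_n),
    Sigma mu -> mu i j = 1 ->
    (0 < payoff U V (L x) x i j ->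
       exists sj : pstrat G j, forall e s, s j = sj ->
         captured_away mu (motion G x mu e s) i j) /\
    (payoff U V (L x) x i j <= 0 ->
       exists ei : estrat G i, forall e s, e i = ei ->
         reaches_target mu (motion G x mu e s) i).

(* Main.v *)
Require Import Defs.
From mathcomp Require Import all_boot all_order all_algebra.
From mathcomp Require Import all_classical all_reals all_analysis.
From mathcomp Require Import ring lra zify.

(** Call an assignment winning at x when the pursuer wins every assigned pairing.
    The theorem comes from two independent facts about winning assignments.

    Game side. The pursuer team wins from x exactly when some feasible assignment
    is winning, and the evader team wins exactly when none is. Given a winning
    assignment, every assigned pursuer plays its one-on-one strategy
    ([pursuers_enforce]); given an assignment that is not winning, one evader
    plays the one-on-one strategy of a pairing it wins ([evaders_enforce]). No
    motion is a win for both teams ([outcomes_exclusive]), so neither team can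
    win where the other one has such a strategy.

    Optimization side. A winning assignment exists exactly when one, equivalently
    every, element g of Gamma_star is winning, that is, has all its row sums
    Psi_row positive. This needs:
    - the extreme points of Gamma are the feasible assignments, and a linear
      function is maximized over Gamma at one of them, so Gamma_star is a
      nonempty set of feasible assignments ([extreme_Gamma_Sigma],
      [Sigma_maximizer], [Gamma_star_nonempty]);
    - a pairing has positive payoff exactly when it is favorable ([payoff_gt0]);
    - because L exceeds Lstar, a single lost pairing makes the total payoff
      negative ([unfavorable_total_lt0]), while a winning assignment has a
      nonnegative total; so as soon as a winning assignment exists, every
      maximizer is winning ([optimal_wins_all_pairings]).

    The integrality of Gamma is the Birkhoff-von Neumann argument. One slack row
    turns g into a matrix with entries in [0, 1] whose row sums and column sums
    are all integers. Each line that has a fractional entry has at least two, so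
    the fractional entries are too many for the line-sum equations to determine
    them ([nonint_direction]); moving along a kernel direction in either sense
    stays in Gamma until a further entry becomes integral ([nonint_pushable]).
    Hence a nonintegral point lies inside a segment of Gamma, and a linear
    function can be improved until all entries are integral. *)

Set Implicit Arguments.
Unset Strict Implicit.
Unset Printing Implicit Defensive.

Import Order.TTheory GRing.Theory Num.Theory.

Local Open Scope classical_set_scope.
Local Open Scope ring_scope.

(** * Fractional entries of matrices with integral line sums *)

Section Integrality.
Variable R : archiRealFieldType.

Lemma other_nonint (I : finType) (f : I -> R) (i0 : I) :
  \sum_i f i \is a Num.int -> f i0 \isn't a Num.int ->
  exists2 i1, i1 != i0 & f i1 \isn't a Num.int.
Proof.
move=> sum_int; apply: contraNP => others.
have -> : f i0 = \sum_i f i - \sum_(i | i != i0) f i.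
  by rewrite (bigD1 i0) //= addrK.
rewrite rpredB // rpred_sum // => i ne_i0.
by apply: contraT => fi; case: others; exists i.
Qed.

Lemma card_imset_paired (T T' : finType) (h : T -> T') (F : {set T}) :
  (forall e, e \in F -> exists2 e', e' \in F & e' != e /\ h e' = h e) ->
  (#|h @: F|%SET * 2 <= #|F|)%N.
Proof.
move=> paired.
rewrite -[#|F|]sum1_card (partition_big h (fun y => y \in (h @: F)%SET)) /=; last first.
  by move=> e eF; apply: imset_f.
rewrite -sum_nat_const; apply: leq_sum => y /imsetP[e eF ->].
have [e' e'F [ne he]] := paired e eF.
rewrite sum1_card; apply/card_gt1P; exists e, e'; split.
- by rewrite unfold_in eF eqxx.
- by rewrite unfold_in e'F he eqxx.
- by rewrite eq_sym.
Qed.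

Definition nonint p q (A : 'M[R]_(p, q)) : {set 'I_p * 'I_q} :=
  [set e | A e.1 e.2 \isn't a Num.int]%SET.

Definition balanced p q (D : 'M[R]_(p, q)) : Prop :=
  (forall i, \sum_j D i j = 0) /\ (forall j, \sum_i D i j = 0).

Lemma sum_delta_in (T : finType) (S : {set T}) (y : T) : y \in S ->
  \sum_(r < #|S|) (y == enum_val r)%:R = 1 :> R.
Proof.
move=> yS; rewrite (bigD1 (enum_rank_in yS y)) //= enum_rankK_in // eqxx.
rewrite big1 ?addr0 // => r; case: (y =P _) => // yr /eqP[].
by apply: enum_val_inj; rewrite enum_rankK_in.
Qed.

(** Dimension count. Let F be the set of fractional entries, in r rows and c
    columns. The line sums of a matrix supported on F are r + c linear functions
    of #|F| unknowns. By [other_nonint] each of these lines meets F at least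
    twice, so r + c <= #|F|; and the functions are dependent, because the row
    sums and the column sums have the same total. Their rank is therefore less
    than #|F|. *)
Lemma nonint_direction p q (A : 'M[R]_(p, q)) :
  (forall i, \sum_j A i j \is a Num.int) ->
  (forall j, \sum_i A i j \is a Num.int) ->
  (0 < #|nonint A|)%N ->
  exists D : 'M[R]_(p, q), [/\ D != 0, balanced D &
    forall i j, D i j != 0 -> A i j \isn't a Num.int].
Proof.
move=> rowA colA; set F := nonint A => F_gt0.
have FE i j : ((i, j) \in F) = (A i j \isn't a Num.int) by rewrite inE.
pose Rs := (fst @: F)%SET; pose Cs := (snd @: F)%SET.
have Rs2 : (#|Rs| * 2 <= #|F|)%N.
  apply: card_imset_paired => -[i j]; rewrite FE => /(other_nonint (rowA i)).
  case=> j' ne Aj'; exists (i, j'); rewrite ?FE //; split=> //.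
  by rewrite xpair_eqE eqxx.
have Cs2 : (#|Cs| * 2 <= #|F|)%N.
  apply: card_imset_paired => -[i j]; rewrite FE.
  move=> /(other_nonint (f := fun i => A i j) (colA j)).
  case=> i' ne Ai'; exists (i', j); rewrite ?FE //; split=> //.
  by rewrite xpair_eqE eqxx andbT.
have inR (a : 'I_#|F|) : (enum_val a).1 \in Rs by apply: imset_f; apply: enum_valP.
have inC (a : 'I_#|F|) : (enum_val a).2 \in Cs by apply: imset_f; apply: enum_valP.
(* Incidence matrices between the entries of F and its rows and columns. *)
pose MR : 'M[R]_(#|F|, #|Rs|) := \matrix_(a, r) ((enum_val a).1 == enum_val r)%:R.
pose MC : 'M[R]_(#|F|, #|Cs|) := \matrix_(a, c) ((enum_val a).2 == enum_val c)%:R.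
(* The dependency: sum of the rows minus sum of the columns. *)
pose v : 'cV[R]_(#|Rs| + #|Cs|) := col_mx (const_mx 1) (const_mx (-1)).
have Mv : row_mx MR MC *m v = 0.
  rewrite mul_row_col; apply/matrixP => a k; rewrite !mxE.
  under eq_bigr do rewrite !mxE mulr1.
  under [X in _ + X]eq_bigr do rewrite !mxE mulrN1.
  by rewrite sumrN !sum_delta_in // subrr.
have Rs_gt0 : (0 < #|Rs|)%N.
  by apply/card_gt0P; case/card_gt0P: F_gt0 => e eF; exists e.1; apply: imset_f.
have v0 : v != 0.
  apply/eqP => /matrixP/(_ (lshift _ (Ordinal Rs_gt0)) ord0).
  by rewrite col_mxEu !mxE => /eqP; rewrite oner_eq0.
have rkM : (\rank (row_mx MR MC) < #|F|)%N.
  have := mulmx0_rank_max Mv.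
  have : (0 < \rank v)%N by rewrite lt0n mxrank_eq0.
  by move: Rs2 Cs2; clear; lia.
have : kermx (row_mx MR MC) != 0 by rewrite -mxrank_eq0 mxrank_ker -lt0n subn_gt0.
case/rowV0Pn => u /sub_kermxP; rewrite mul_mx_row => uM u0.
have [uR uC] : u *m MR = 0 /\ u *m MC = 0.
  by apply: eq_row_mx; rewrite uM row_mx0.
pose D : 'M[R]_(p, q) := \matrix_(i, j) \sum_a u 0 a * (enum_val a == (i, j))%:R.
have DE (a : 'I_#|F|) : D (enum_val a).1 (enum_val a).2 = u 0 a.
  rewrite mxE (bigD1 a) //= -surjective_pairing eqxx mulr1 big1 ?addr0 // => b ne.
  by rewrite (inj_eq enum_val_inj) (negPf ne) mulr0.
exists D; split.
- apply: contraNneq u0 => D0; apply/eqP/rowP => a.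
  by rewrite -DE D0 !mxE.
- split=> [i|j].
  + have -> : \sum_j D i j = \sum_a u 0 a * ((enum_val a).1 == i)%:R.
      under eq_bigr do rewrite mxE.
      rewrite exchange_big; apply: eq_bigr => a _; rewrite -mulr_sumr; congr (_ * _).
      rewrite (bigD1 (enum_val a).2) //= big1 ?addr0 => [|j ne].
        by rewrite [in LHS](surjective_pairing (enum_val a)) xpair_eqE eqxx andbT.
      by rewrite [enum_val a]surjective_pairing xpair_eqE [_ == j]eq_sym (negPf ne) andbF.
    have [iR|iR] := boolP (i \in Rs).
      have /matrixP/(_ ord0 (enum_rank_in iR i)) := uR; rewrite !mxE => {2}<-.
      by apply: eq_bigr => a _; rewrite mxE enum_rankK_in.
    rewrite big1 // => a _; case: eqP => [ai|]; last by rewrite mulr0.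
    by rewrite -ai inR in iR.
  + have -> : \sum_i D i j = \sum_a u 0 a * ((enum_val a).2 == j)%:R.
      under eq_bigr do rewrite mxE.
      rewrite exchange_big; apply: eq_bigr => a _; rewrite -mulr_sumr; congr (_ * _).
      rewrite (bigD1 (enum_val a).1) //= big1 ?addr0 => [|i ne].
        by rewrite [in LHS](surjective_pairing (enum_val a)) xpair_eqE eqxx.
      by rewrite [enum_val a]surjective_pairing xpair_eqE [_ == i]eq_sym (negPf ne).
    have [jC|jC] := boolP (j \in Cs).
      have /matrixP/(_ ord0 (enum_rank_in jC j)) := uC; rewrite !mxE => {2}<-.
      by apply: eq_bigr => a _; rewrite mxE enum_rankK_in.
    rewrite big1 // => a _; case: eqP => [aj|]; last by rewrite mulr0.
    by rewrite -aj inC in jC.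
- move=> i j; rewrite mxE -FE; apply: contraNT => ijF.
  rewrite big1 // => a _; case: eqP => [aij|]; last by rewrite mulr0.
  by rewrite -aij enum_valP in ijF.
Qed.

(** Going from A in the direction D, the first entry to hit a face of the cube
    becomes 0 or 1, while the entries that were integral do not move. *)
Lemma push_to_face p q (A D : 'M[R]_(p, q)) :
  (forall i j, 0 <= A i j <= 1) -> D != 0 ->
  (forall i j, D i j != 0 -> A i j \isn't a Num.int) ->
  exists t, [/\ 0 < t, forall i j, 0 <= (A + t *: D) i j <= 1 &
    (#|nonint (A + t *: D)| < #|nonint A|)%N].
Proof.
move=> A01 D0 Dsupp.
have /existsP[e0 De0] : [exists e : 'I_p * 'I_q, D e.1 e.2 != 0].
  apply: contraNT D0 => /existsPn noD; apply/eqP/matrixP => i j; rewrite mxE.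
  by apply/eqP; have := noD (i, j); rewrite negbK.
(* The time at which the entry e leaves the interval [0, 1]. *)
pose step (e : 'I_p * 'I_q) :=
  if 0 < D e.1 e.2 then (1 - A e.1 e.2) / D e.1 e.2 else A e.1 e.2 / - D e.1 e.2.
case: (@arg_minP _ _ _ e0 (fun e => D e.1 e.2 != 0) step De0) => e De mine.
have inside i j : D i j != 0 -> 0 < A i j < 1.
  move=> /Dsupp nA; have /andP[A0 A1] := A01 i j; apply/andP; split.
    by rewrite lt_neqAle A0 andbT; apply: contraNneq nA => <-.
  by rewrite lt_neqAle A1 andbT; apply: contraNneq nA => ->.
have step_gt0 : 0 < step e.
  have /andP[Ae0 Ae1] := inside _ _ De.
  rewrite /step; case: (ltP 0 (D e.1 e.2)) => De_sgn; rewrite divr_gt0 ?subr_gt0 //.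
  by rewrite oppr_gt0 lt_neqAle De.
exists (step e); split=> // [i j|].
  rewrite !mxE; have [->|Dij] := eqVneq (D i j) 0; first by rewrite mulr0 addr0.
  have := mine (i, j) Dij; rewrite {2}/step /=.
  have /andP[Aij0 Aij1] := inside _ _ Dij.
  case: (ltP 0 (D i j)) => sD.
    rewrite ler_pdivlMr // => h.
    by have h0 := mulr_gt0 step_gt0 sD; apply/andP; split; lra.
  have nD : 0 < - D i j by rewrite oppr_gt0 lt_neqAle Dij.
  rewrite ler_pdivlMr // mulrN => h.
  by have h0 := mulr_gt0 step_gt0 nD; rewrite mulrN in h0; apply/andP; split; lra.
apply: proper_card; apply/properP; split.
  apply/fintype.subsetP => -[i j]; rewrite !inE !mxE /=; apply: contraNN => Aint.
  have [->|/Dsupp] := eqVneq (D i j) 0; first by rewrite mulr0 addr0.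
  by rewrite Aint.
exists e; first by rewrite inE Dsupp.
rewrite inE negbK !mxE /step; case: ifP => _.
  by rewrite divfK // addrC subrK.
by rewrite invrN mulrN mulNr divfK // subrr.
Qed.

End Integrality.

(** * The assignment polytope *)

Section AssignmentPolytope.
Variables (R : realType) (m n : nat).
Implicit Types g mu D : 'M[R]_(m, n).

Lemma row_col_sumsP g : row_col_sums g <->
  (forall i, \sum_j g i j = 1) /\ (forall j, \sum_i g i j <= 1).
Proof.
rewrite /row_col_sums.
have rowE i k : (g *m const_mx 1 : 'cV_m) i k = \sum_j g i j.
  by rewrite mxE; apply: eq_bigr => j _; rewrite mxE mulr1.
have colE j : (g^T *m const_mx 1 : 'cV_n) j 0 = \sum_i g i j.
  by rewrite mxE; apply: eq_bigr => i _; rewrite !mxE mulr1.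
split=> -[rows cols].
  by split=> [i|j]; [rewrite -(rowE i 0) rows mxE | rewrite -colE].
split=> [|j]; last by rewrite colE.
by apply/matrixP => i k; rewrite rowE rows mxE.
Qed.

(** The slack row turns the column constraints into equations; its own sum
    n - m is an integer, so all line sums become integral. *)
Definition with_slack g : 'M[R]_(m + 1, n) :=
  col_mx g (\row_j (1 - \sum_i g i j)).

Lemma Gamma_with_slack g : Gamma g <->
  (forall i j, 0 <= with_slack g i j <= 1) /\ (forall i, \sum_j g i j = 1).
Proof.
split=> [[g01 /row_col_sumsP[rows cols]]|[s01 rows]].
  split=> // i j; rewrite -[i]splitK; case: (fintype.split i) => k /=.
    by rewrite col_mxEu.
  rewrite col_mxEd mxE subr_ge0 cols gerBl sumr_ge0 // => l _.
  by case/andP: (g01 l j).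
have g01 i j : 0 <= g i j <= 1 by move: (s01 (lshift 1 i) j); rewrite col_mxEu.
split=> //; apply/row_col_sumsP; split=> // j.
by move: (s01 (rshift m ord0) j); rewrite col_mxEd mxE subr_ge0 => /andP[].
Qed.

Lemma with_slack_col g j : \sum_i with_slack g i j = 1.
Proof.
rewrite big_split_ord /= big_ord1 col_mxEd mxE.
by under eq_bigr do rewrite col_mxEu; rewrite addrC subrK.
Qed.

Lemma with_slack_row_int g : (forall i, \sum_j g i j = 1) ->
  forall i, \sum_j with_slack g i j \is a Num.int.
Proof.
move=> rows i; rewrite -[i]splitK; case: (fintype.split i) => k /=.
  by under eq_bigr do rewrite col_mxEu; rewrite rows rpred1.
under eq_bigr do rewrite col_mxEd mxE.
rewrite sumrB exchange_big /=.
by apply: rpredB; apply: rpred_sum => l _; rewrite ?rows rpred1.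
Qed.

(** The number of fractional entries is the measure for descending to Sigma. *)
Definition pushable g D : Prop :=
  exists t, [/\ 0 < t, Gamma (g + t *: D) &
    (#|nonint (with_slack (g + t *: D))| < #|nonint (with_slack g)|)%N].

(** A direction E found for the completed matrix restricts to a direction D for
    g, and its last row is exactly the variation of the slacks, because the
    columns of E sum to zero. *)
Lemma nonint_pushable g : Gamma g -> (0 < #|nonint (with_slack g)|)%N ->
  exists D, [/\ D != 0, pushable g D & pushable g (- D)].
Proof.
move=> /Gamma_with_slack[s01 rows] frac.
have [|E [E0 [Erow Ecol] Esupp]] := nonint_direction (with_slack_row_int rows) _ frac.
  by move=> j; rewrite with_slack_col rpred1.
pose D := usubmx E.
have slackD (c : R) : with_slack (g + c *: D) = with_slack g + c *: E.
  rewrite -[E]vsubmxK /with_slack scale_col_mx add_col_mx; congr col_mx.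
  apply/rowP => j; rewrite !mxE.
  have := Ecol j; rewrite big_split_ord /= big_ord1 => /eqP.
  rewrite addrC addr_eq0 => /eqP ->.
  under eq_bigr do rewrite !mxE.
  by rewrite big_split /= -mulr_sumr mulrN opprD addrA.
have push (E1 : 'M[R]_(m + 1, n)) (c : R) : c != 0 -> E1 = c *: E -> pushable g (c *: D).
  move=> c0 E1E.
  have [||t [t_gt0 t01 t_lt]] := push_to_face (D := E1) s01.
  - by rewrite E1E scaler_eq0 (negPf c0).
  - by move=> i j; rewrite E1E mxE mulf_eq0 (negPf c0); exact: Esupp.
  rewrite E1E scalerA -slackD -scalerA in t01 t_lt.
  exists t; split=> //; apply/Gamma_with_slack; split=> // i.
  under eq_bigr do rewrite !mxE mulrA.
  by rewrite big_split /= rows -mulr_sumr Erow mulr0 addr0.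
exists D; split.
(* If D vanished, so would the slack row of E. *)
- apply: contraNneq E0 => D0; have := slackD 1; rewrite D0 scaler0 addr0 scale1r.
  by move=> /eqP; rewrite -subr_eq0 opprD addNKr oppr_eq0.
- by rewrite -[D]scale1r; apply: (push E); rewrite ?oner_eq0 ?scale1r.
- by rewrite -scaleN1r; apply: (push (- E)); rewrite ?oppr_eq0 ?oner_eq0 ?scaleN1r.
Qed.

Lemma nonint0_Sigma g : Gamma g -> #|nonint (with_slack g)| = 0%N -> Sigma g.
Proof.
move=> [g01 sums] /eqP; rewrite cards_eq0 => /eqP no_nonint; split=> // i j.
have : (lshift 1 i, j) \notin nonint (with_slack g) by rewrite no_nonint inE.
rewrite inE /= col_mxEu negbK => /intrP[z gz]; move: (g01 i j); rewrite gz.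
rewrite ler0z -[1]/(1%:~R) ler_int => z01.
have [-> | ->] : z = 0 \/ z = 1 by lia.
  by left.
by right.
Qed.

(** A point that can be pushed along both D and - D lies inside a segment of
    Gamma. *)
Lemma extreme_Gamma_Sigma g : extreme_point (@Gamma R m n) g -> Sigma g.
Proof.
move=> [Gg ext].
have [frac0|frac] := posnP #|nonint (with_slack g)|; first exact: nonint0_Sigma.
have [D [D0 [t [t_gt0 Gt _]] [s [s_gt0 Gs _]]]] := nonint_pushable Gg frac.
have ts_gt0 : 0 < t + s by rewrite addr_gt0.
(* This weight is the barycentric coordinate of g between g + t D and g - s D. *)
have [] := ext _ _ (s / (t + s)) Gt Gs.
- by rewrite divr_gt0 //= ltr_pdivrMr // mul1r ltrDr.
- apply/matrixP => i j; rewrite !mxE; field; exact: lt0r_neq0.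
move=> /eqP; rewrite -subr_eq0 addrC addKr scaler_eq0 (negPf D0) orbF.
by rewrite gt_eqF.
Qed.

Lemma Sigma_sub_Gamma : @Sigma R m n `<=` @Gamma R m n.
Proof.
move=> mu [mu01 sums]; split=> // i j.
by case: (mu01 i j) => ->; rewrite ?lexx ?ler01.
Qed.

(** The entries of mu are extreme points of [0, 1]. *)
Lemma Sigma_extreme_Gamma mu : Sigma mu -> extreme_point (@Gamma R m n) mu.
Proof.
move=> Smu; split; first exact: Sigma_sub_Gamma.
move=> g1 g2 t [g1_01 _] [g2_01 _] /andP[t0 t1] mu_eq.
suff same i j : g1 i j = mu i j /\ g2 i j = mu i j.
  by split; apply/matrixP => i j; case: (same i j).
have := congr1 (fun M : 'M[R]_(m, n) => M i j) mu_eq; rewrite !mxE => eq_ij.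
case/andP: (g1_01 i j) => a0 a1; case/andP: (g2_01 i j) => b0 b1.
by case: Smu => /(_ i j)[] mu_ij _; rewrite mu_ij in eq_ij *; split; nra.
Qed.

Section LinearObjective.
Variable w : 'I_m -> 'I_n -> R.
Let obj g := \sum_i \sum_j w i j * g i j.

Let obj_line g t D : obj (g + t *: D) = obj g + t * obj D.
Proof.
rewrite /obj mulr_sumr -big_split; apply: eq_bigr => i _ /=.
rewrite mulr_sumr -big_split; apply: eq_bigr => j _ /=.
by rewrite !mxE; ring.
Qed.

(** Of the two opposite directions, one does not decrease the objective; pushing
    along it reduces the number of fractional entries. *)
Lemma Gamma_le_Sigma g : Gamma g -> exists2 mu, Sigma mu & obj g <= obj mu.
Proof.
have [k] := ubnP #|nonint (with_slack g)|; elim: k => // k IHk in g * => lt_k Gg.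
have [frac0|frac] := posnP #|nonint (with_slack g)|.
  by exists g => //; exact: nonint0_Sigma.
have [D0 [_ pushD pushND]] := nonint_pushable Gg frac.
have [D D_ge0 [t [t_gt0 Gt t_lt]]] : exists2 D, 0 <= obj D & pushable g D.
  have [D_ge0|/ltW D_le0] := leP 0 (obj D0); first by exists D0.
  exists (- D0) => //; have := obj_line 0 (-1) D0.
  rewrite add0r scaleN1r mulN1r => ->; rewrite -[X in X <= _]addr0 lerD ?oppr_ge0 //.
  by rewrite /obj big1 // => i _; rewrite big1 // => j _; rewrite mxE mulr0.
have [|mu Smu le_mu] := IHk _ _ Gt; first by rewrite (leq_trans t_lt).
by exists mu => //; apply: le_trans le_mu; rewrite obj_line lerDl mulr_ge0 // ltW.
Qed.

(** Sigma is finite: its elements are images of boolean matrices. A maximizer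
    over it is a maximizer over Gamma by [Gamma_le_Sigma]. *)
Lemma Sigma_maximizer : (exists mu, @Sigma R m n mu) ->
  exists2 mu, Sigma mu & forall g, Gamma g -> obj g <= obj mu.
Proof.
pose M (b : 'M[bool]_(m, n)) : 'M[R]_(m, n) := map_mx (fun c : bool => c%:R) b.
have SigmaM mu : Sigma mu -> exists b, mu = M b.
  move=> [mu01 _]; exists (map_mx (fun a => a == 1) mu); apply/matrixP => i j.
  by rewrite !mxE; case: (mu01 i j) => ->; rewrite ?eqxx // eq_sym oner_eq0.
move=> [mu0 Smu0]; have [b0 mu0E] := SigmaM _ Smu0.
pose P b := `[< Sigma (M b) >].
have Pb0 : P b0 by apply/asboolP; rewrite -mu0E.
case: (@arg_maxP _ _ _ b0 P (obj \o M) Pb0) => b /asboolP Sb maxb.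
exists (M b) => // g /Gamma_le_Sigma[mu Smu le_mu].
apply: le_trans le_mu _; have [b1 muE] := SigmaM _ Smu.
by rewrite muE; apply: maxb; apply/asboolP; rewrite -muE.
Qed.

End LinearObjective.

Lemma SigmaP mu : Sigma mu <->
  exists2 f : 'I_m -> 'I_n, injective f & mu = \matrix_(i, j) (f i == j)%:R.
Proof.
split=> [[mu01 /row_col_sumsP[rows cols]]|[f inj_f ->]].
  have mu_ge0 i j : 0 <= mu i j by case: (mu01 i j) => ->; rewrite ?ler01.
  have /choice[f fP] i : exists j, mu i j = 1.
    apply: contrapT => no_one; move: (rows i); rewrite big1 => [/eqP|j _].
      by rewrite eq_sym oner_eq0.
    by case: (mu01 i j) => // mu1; case: no_one; exists j.
  exists f.
    move=> i i' ff; apply/eqP; apply: contraT => ne.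
    move: (cols (f i)); rewrite (bigD1 i) //= (bigD1 i') 1?eq_sym //=.
    by rewrite fP ff fP leNgt -subr_gt0 [1 + (1 + _)]addrC addrK ltr_wpDr ?sumr_ge0.
  apply/matrixP => i j; rewrite mxE; case: eqP => [<-|/eqP ne]; first exact: fP.
  move: (rows i); rewrite (bigD1 (f i)) //= fP => /eqP.
  rewrite -subr_eq0 addrAC subrr add0r psumr_eq0 // => /allP/(_ j).
  by rewrite mem_index_enum eq_sym ne => /(_ isT)/eqP.
split=> [i j|]; first by rewrite mxE; case: eqP; [right|left].
apply/row_col_sumsP; split=> [i|j].
  rewrite (bigD1 (f i)) //= mxE eqxx big1 ?addr0 // => j ne.
  by rewrite mxE eq_sym (negPf ne).
have [[i fi]|no_i] := pselect (exists i, f i = j).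
  rewrite (bigD1 i) //= mxE fi eqxx big1 ?addr0 // => i' ne.
  by rewrite mxE -fi (inj_eq inj_f) (negPf ne).
rewrite big1 ?ler01 // => i _; rewrite mxE; case: eqP => // fi.
by case: no_i; exists i.
Qed.

Lemma Sigma_nonempty : (m <= n)%N -> exists mu, @Sigma R m n mu.
Proof.
move=> le_mn; exists (\matrix_(i, j) (widen_ord le_mn i == j)%:R).
by apply/SigmaP; exists (widen_ord le_mn) => // i i' /(congr1 val)/= /val_inj.
Qed.

End AssignmentPolytope.

(** * Sign of the payoffs and effect of the penalty *)

Section EuclideanNorm.
Variables (R : realType) (k : nat).
Implicit Types v : 'rV[R]_k.

Lemma enorm_ge0 v : 0 <= enorm v.
Proof. exact: sqrtr_ge0. Qed.

Lemma enorm_sqr v : enorm v ^+ 2 = \sum_l v 0 l ^+ 2.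
Proof. by rewrite sqr_sqrtr // sumr_ge0 // => l _; rewrite sqr_ge0. Qed.

Lemma enormZ (c : R) v : 0 <= c -> enorm (c *: v) = c * enorm v.
Proof.
move=> c0; apply/eqP; rewrite -(eqrXn2 (n := 2)) ?mulr_ge0 ?enorm_ge0 //.
rewrite exprMn !enorm_sqr mulr_sumr; apply/eqP/eq_bigr => l _.
by rewrite mxE exprMn.
Qed.

Lemma enorm_eq0 v : enorm v = 0 -> v = 0.
Proof.
move=> v0; have /eqP := enorm_sqr v; rewrite v0 expr0n eq_sym.
rewrite psumr_eq0 => [/allP all0|l _]; last exact: sqr_ge0.
apply/rowP => l; rewrite mxE; apply/eqP.
by rewrite -sqrf_eq0; apply: all0; rewrite mem_index_enum.
Qed.

(** For a < 1 the vector (e - a^2 p) / (1 - a^2) is the centre of the Apollonius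
    sphere of e and p, and a |p - e| / (1 - a^2) is its radius. So the power of
    the origin with respect to this sphere has the sign of the barrier. *)
Lemma apollonius_identity (a : R) (e p : 'rV[R]_k) :
  enorm (e - a ^+ 2 *: p) ^+ 2 - (a * enorm (p - e)) ^+ 2 =
  (1 - a ^+ 2) * (enorm e ^+ 2 - a ^+ 2 * enorm p ^+ 2).
Proof.
rewrite exprMn !enorm_sqr !mulr_sumr -!sumrB mulr_sumr.
by apply: eq_bigr => l _; rewrite !mxE; ring.
Qed.

End EuclideanNorm.

Section Payoffs.
Variables (R : realType) (m n : nat) (U : 'I_m -> R) (V : 'I_n -> R).
Hypotheses (U_gt0 : forall i, 0 < U i) (V_gt0 : forall j, 0 < V j).
Variables (x : state R m n) (L : R).
Hypotheses (L_gt0 : 0 < L) (L_gt : Lstar U V x < L).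

Lemma value_P_gt0 i j : favorable U V x i j -> 0 < value_P U V x i j.
Proof.
rewrite /favorable /barrier /value_P; set a := alpha U V i j.
have a_gt0 : 0 < a by rewrite divr_gt0.
move=> /andP[B_gt0 a_le1]; case: (ltP a 1) => [a_lt1|a_ge1].
  have d_gt0 : 0 < 1 - a ^+ 2 by rewrite subr_gt0 expr_lt1 ?ltW.
  rewrite enormZ ?invr_ge0 ?ltW // mulrAC [_ * (1 - a ^+ 2)^-1]mulrC -mulrBr.
  rewrite mulr_gt0 ?invr_gt0 // subr_gt0.
  have aPE_ge0 : 0 <= a * enorm (x.2 j - x.1 i) by rewrite mulr_ge0 ?enorm_ge0 ?ltW.
  rewrite -(ltr_pXn2r (n := 2)) ?nnegrE ?enorm_ge0 ?aPE_ge0 //.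
  by rewrite -subr_gt0 apollonius_identity mulr_gt0.
have a1 : a = 1 by apply/eqP; rewrite eq_le a_le1.
rewrite a1 expr1n mul1r in B_gt0.
rewrite divr_gt0 // mulr_gt0 // lt_neqAle enorm_ge0 andbT eq_sym.
apply: contraTneq B_gt0 => /enorm_eq0/subr0_eq ->.
by rewrite subrr ltxx.
Qed.

Lemma payoff_gt0 i j : (0 < payoff U V L x i j) = favorable U V x i j.
Proof.
rewrite /payoff; case: ifP => [/value_P_gt0 //|_].
by rewrite oppr_gt0 ltNge ltW.
Qed.

(** Lstar bounds what the other rows can contribute, and the lost pairing costs
    L > Lstar. *)
Lemma unfavorable_total_lt0 (f : 'I_m -> 'I_n) (i0 : 'I_m) :
  payoff U V L x i0 (f i0) <= 0 -> \sum_i payoff U V L x i (f i) < 0.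
Proof.
rewrite leNgt payoff_gt0 => unfav.
pose best i := \big[Num.max/0]_(j < n | favorable U V x i j) value_P U V x i j.
have best_ge0 i : 0 <= best i by exact: bigmax_ge_id.
have le_best i : payoff U V L x i (f i) <= best i.
  rewrite /payoff; case: ifP => [fav|_]; first exact: le_bigmax_cond.
  by apply: le_trans (best_ge0 i); rewrite oppr_le0 ltW.
rewrite (bigD1 i0) //= {1}/payoff (negPf unfav) addrC subr_lt0.
apply: le_lt_trans L_gt; rewrite /Lstar [X in _ <= X](bigD1 i0) //=.
by rewrite ler_wpDl ?best_ge0 // ler_sum.
Qed.

Lemma Psi_row_injection (f : 'I_m -> 'I_n) i :
  Psi_row U V L x (\matrix_(i, j) (f i == j)%:R) i = payoff U V L x i (f i).
Proof.
rewrite /Psi_row (bigD1 (f i)) //= mxE eqxx mulr1 big1 ?addr0 // => j ne.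
by rewrite mxE eq_sym (negPf ne) mulr0.
Qed.

Lemma Psi_row_assigned mu i j : Sigma mu -> mu i j = 1 ->
  Psi_row U V L x mu i = payoff U V L x i j.
Proof.
move=> /SigmaP[f _ ->]; rewrite mxE Psi_row_injection.
by case: eqP => [-> //|_ /esym/eqP]; rewrite oner_eq0.
Qed.

Lemma Gamma_star_Sigma g : Gamma_star U V L x g -> Sigma g.
Proof. by move=> [/extreme_Gamma_Sigma]. Qed.

Lemma Gamma_star_nonempty : (m <= n)%N -> exists g, Gamma_star U V L x g.
Proof.
move=> /(Sigma_nonempty R)/(Sigma_maximizer (payoff U V L x))[mu Smu mu_max].
by exists mu; split=> //; exact: Sigma_extreme_Gamma.
Qed.

(** On Sigma, the row sum of evader i is the payoff of its assigned pairing, by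
    [Psi_row_assigned]. *)
Definition wins_all_pairings (mu : 'M[R]_(m, n)) : Prop :=
  forall i, 0 < Psi_row U V L x mu i.

(** mu has nonnegative total payoff, hence so has the maximizer g, which rules
    out a lost pairing in g. *)
Lemma optimal_wins_all_pairings g mu : Gamma_star U V L x g ->
  Sigma mu -> wins_all_pairings mu -> wins_all_pairings g.
Proof.
move=> opt_g Smu win_mu i; have /SigmaP[f _ gE] := Gamma_star_Sigma opt_g.
rewrite ltNge; apply/negP; rewrite gE Psi_row_injection => /unfavorable_total_lt0.
apply/negP; rewrite -leNgt.
apply: (@le_trans _ _ (Psi U V L x mu)); first by apply: sumr_ge0 => l _; rewrite ltW.
have [_ /(_ mu (Sigma_sub_Gamma Smu))] := opt_g.
by rewrite gE {2}/Psi; under [X in _ <= X]eq_bigr do rewrite Psi_row_injection.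
Qed.

End Payoffs.

(** Positivity passes to the infimum because the range is finite: the infimum is
    attained. *)
Lemma inf_range_gt0 (R : realType) (I : finType) (i0 : I) (F : I -> R) :
  0 < inf (range F) <-> forall i, 0 < F i.
Proof.
have [i _ minF] := @arg_minP _ _ _ i0 predT F isT.
suff -> : inf (range F) = F i.
  by split=> [Fi_gt0 l|//]; apply: lt_le_trans (minF l isT).
apply/eqP; rewrite eq_le; apply/andP; split.
  by apply: ge_inf; [exists (F i) => _ [l _ <-]; exact: minF | exists i].
by apply: lb_le_inf; [exists (F i0), i0 | move=> _ [l _ <-]; exact: minF].
Qed.

(** * Strategies of the teams *)

Section Outcomes.
Variables (R : realType) (m n : nat) (U : 'I_m -> R) (V : 'I_n -> R).

(** Whichever event occurs first contradicts the other: a capture stops the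
    evader before the target, and an earlier visit to the target means that the
    capture is not away from it. *)
Lemma captured_away_not_reaches (mu : 'M[R]_(m, n)) (p : R -> state R m n) i j :
  captured_away mu p i j -> ~ reaches_target mu p i.
Proof.
move=> [t [t_ge0 cap away]] [t' [t'_ge0 at0 uncaught]].
have [le_t't|lt_tt'] := leP t' t; first by apply: (away t') => //; rewrite t'_ge0.
by apply: (uncaught t j) => //; rewrite t_ge0.
Qed.

Lemma outcomes_exclusive (mu : 'M[R]_(m, n)) (p : R -> state R m n) :
  pursuers_win mu p -> ~ evaders_win mu p.
Proof. by move=> win [i]; case: (win i) => j /captured_away_not_reaches. Qed.

Variables (L : state R m n -> R) (G : game U V).
Hypothesis pairings : one_on_one_outcomes L G.

(** The one-on-one strategies combine into a team strategy because a pursuer is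
    assigned to at most one evader; the unassigned pursuers play anything. *)
Lemma pursuers_enforce x mu : Sigma mu -> wins_all_pairings U V x (L x) mu ->
  exists s : forall j, pstrat G j, forall e, pursuers_win mu (motion G x mu e s).
Proof.
move=> Smu win; have /SigmaP[f inj_f muE] := Smu.
have mu1 i : mu i (f i) = 1 by rewrite muE mxE eqxx.
have duel j : exists sj : pstrat G j, forall i, f i = j -> forall e s, s j = sj ->
    captured_away mu (motion G x mu e s) i j.
  have [[i fi]|no_i] := pselect (exists i, f i = j); last first.
    by exists (pstrat_point G j) => i fi; case: no_i; exists i.
  subst j; have [|sj sjP] := (pairings x Smu (mu1 i)).1.
    by rewrite -(Psi_row_assigned _ _ _ _ Smu (mu1 i)).
  by exists sj => i' /inj_f ->.
exists (fun j => projT1 (cid (duel j))) => e i; exists (f i).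
exact: (projT2 (cid (duel (f i)))).
Qed.

(** One losing pairing suffices: its evader plays the one-on-one strategy and
    the others play anything. *)
Lemma evaders_enforce x mu i : Sigma mu -> Psi_row U V (L x) x mu i <= 0 ->
  exists e : forall i, estrat G i, forall s, evaders_win mu (motion G x mu e s).
Proof.
move=> Smu lose; have /SigmaP[f _ muE] := Smu.
have mu1 : mu i (f i) = 1 by rewrite muE mxE eqxx.
rewrite (Psi_row_assigned _ _ _ _ Smu mu1) in lose.
have duel k : exists ek : estrat G k, k = i -> forall e s, e k = ek ->
    reaches_target mu (motion G x mu e s) k.
  have [->|ne] := eqVneq k i; last first.
    by exists (estrat_point G k) => ki; rewrite ki eqxx in ne.
  by have [ei eiP] := (pairings x Smu mu1).2 lose; exists ei.
exists (fun k => projT1 (cid (duel k))) => s; exists i.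
exact: (projT2 (cid (duel i))).
Qed.

End Outcomes.

Theorem theorem4 (R : realType) (m n : nat) (m_ge1 : (1 <= m)%N)
    (n_ge_m : (m <= n)%N)
    (U : 'I_m -> R) (V : 'I_n -> R)
    (U_gt0 : forall i, 0 < U i) (V_gt0 : forall j, 0 < V j)
    (L : state R m n -> R)
    (L_gt0 : forall x, 0 < L x) (L_gt : forall x, Lstar U V x < L x)
    (G : game U V) (pairings : one_on_one_outcomes L G) :
  winning_P G =
    [set x | forall g, Gamma_star U V (L x) x g ->
               0 < team_barrier U V (L x) x g] /\
  winning_E G =
    [set x | forall g, Gamma_star U V (L x) x g ->
               team_barrier U V (L x) x g <= 0].
Proof.
pose winnable x := exists2 mu, Sigma mu & wins_all_pairings U V x (L x) mu.
have barrier_gt0 x g :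
    0 < team_barrier U V (L x) x g <-> wins_all_pairings U V x (L x) g.
  exact: (inf_range_gt0 (Ordinal m_ge1)).
have winnable_opt x g : Gamma_star U V (L x) x g ->
    winnable x <-> 0 < team_barrier U V (L x) x g.
  move=> opt_g; rewrite barrier_gt0; split=> [[mu Smu win_mu]|win_g].
    exact: (optimal_wins_all_pairings U_gt0 V_gt0 (L_gt0 x) (L_gt x) opt_g Smu win_mu).
  by exists g => //; exact: Gamma_star_Sigma opt_g.
have lose_ex x mu : ~ wins_all_pairings U V x (L x) mu ->
    exists i, Psi_row U V (L x) x mu i <= 0.
  by move=> /existsNP[i /negP]; rewrite -leNgt; exists i.
split; apply/seteqP; split=> x /=.
- move=> [mu [s [Smu win]]] g opt_g; apply/(winnable_opt _ _ opt_g).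
  exists mu => //; apply: contrapT => /lose_ex[i /(evaders_enforce pairings Smu)[e he]].
  exact: outcomes_exclusive (win (fun=> e)) (he s).
- move=> all_gt0; have [g opt_g] := Gamma_star_nonempty U V x (L x) n_ge_m.
  have [mu Smu win] := (winnable_opt _ _ opt_g).2 (all_gt0 g opt_g).
  have [s hs] := pursuers_enforce pairings Smu win.
  by exists mu, s; split=> // e; exact: hs.
- move=> [e win] g opt_g; rewrite leNgt; apply/negP.
  move=> /(winnable_opt _ _ opt_g)[mu Smu win_mu].
  have [s hs] := pursuers_enforce pairings Smu win_mu.
  exact: outcomes_exclusive (hs (e mu)) (win mu s Smu).
- move=> all_le0; have [g opt_g] := Gamma_star_nonempty U V x (L x) n_ge_m.
  have no_win : ~ winnable x.
    by move=> /(winnable_opt _ _ opt_g); rewrite ltNge all_le0.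
  have respond mu : exists e : forall i, estrat G i,
      Sigma mu -> forall s, evaders_win mu (motion G x mu e s).
    have [Smu|nSmu] := pselect (Sigma mu); last first.
      by exists (fun i => estrat_point G i).
    have [|i /(evaders_enforce pairings Smu)[e he]] := lose_ex x mu.
      by move=> win; apply: no_win; exists mu.
    by exists e.
  (* The evaders see the assignment, so they may answer each one separately. *)
  have /choice[e he] := respond.
  by exists e => mu s Smu; exact: he.
Qed.
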